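(* Let $\psi\colon G\twoheadrightarrow H$ be an epimorphism of commutative groups. Then $\operatorname{Ker}(\psi)$ is finite if and only if for every $G$-graded ring $R$ the $\psi$-coarsening functor $\bullet_{[\psi]}\colon\mathsf{GrMod}^G(R)\rightarrow\mathsf{GrMod}^H(R_{[\psi]})$ preserves injectivity (that is, for every injective object $M$ of $\mathsf{GrMod}^G(R)$, the object $M_{[\psi]}$ of $\mathsf{GrMod}^H(R_{[\psi]})$ is injective).
   Context: All groups and rings are commutative; groups are written additively. A $G$-graded ring is a ring $R$ with a family $(R_g)_{g\in G}$ of additive subgroups such that $R=\bigoplus_{g\in G}R_g$ and $R_gR_h\subseteq R_{g+h}$ for $g,h\in G$. A $G$-graded $R$-module is an $R$-module $M$ with a family $(M_g)_{g\in G}$ of additive subgroups such that $M=\bigoplus_{g\in G}M_g$ and $R_gM_h\subseteq M_{g+h}$ for $g,h\in G$. $\mathsf{GrMod}^G(R)$ is the (abelian) category of $G$-graded $R$-modules whose morphisms are the $R$-linear maps $u\colon M\rightarrow N$ with $u(M_g)\subseteq N_g$ for all $g\in G$. $\psi$-coarsening: $R_{[\psi]}$ is the $H$-graded ring with the same underlying ring as $R$ and with component $\bigoplus_{g\in\psi^{-1}(h)}R_g$ in degree $h\in H$. For a $G$-graded $R$-module $M$, $M_{[\psi]}$ is the $H$-graded $R_{[\psi]}$-module with the same underlying module and with component $\bigoplus_{g\in\psi^{-1}(h)}M_g$ in degree $h\in H$; on morphisms, $u_{[\psi]}$ has the same underlying map as $u$. *)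

(* Defs.v *)
From HB Require Import structures.
From mathcomp Require Import all_boot all_algebra.
From mathcomp Require Import finmap.
From mathcomp Require Import boolp classical_sets functions cardinality fsbigop.

Set Implicit Arguments.
Unset Strict Implicit.
Unset Printing Implicit Defensive.

Import GRing.Theory.

Local Open Scope classical_set_scope.
Local Open Scope ring_scope.

Section DirectSum.
Variables (I : choiceType) (V : zmodType).
Implicit Types (C : I -> zmodClosed V) (D : set I).

(* The finite-support condition is needed on its own: over an infinite support
   the library's [\sum_(i \in _)] is 0 by convention. *)
Definition decomposition C (x : V) (f : I -> V) : Prop :=
  [/\ forall i, f i \in C i,
      finite_set [set i | f i != 0]
    & x = \sum_(i \in [set: I]) f i].

Definition is_direct_sum C : Prop := forall x, exists! f, decomposition C x f.

(* The sum, inside V, of the subgroups C i with i in D; it is their direct sum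
   as soon as the whole family is independent. *)
Definition subsum C D : {pred V} := fun x =>
  `[< exists2 f, decomposition C x f & forall i, ~ D i -> f i = 0 >].

Lemma decompositionP C x f : decomposition C x f <->
  (forall i, f i \in C i) /\ exists2 A : {fset I},
    (forall i, i \notin A -> f i = 0) & x = \sum_(i <- A) f i.
Proof.
split=> [[fC fin_f ->]|[fC [A fA0 ->]]]; last first.
  split=> //; last by rewrite (fsbigTE _ _ fA0).
  apply: sub_finite_set (finite_fset A) => i /=; apply: contra_neqT.
  exact: fA0.
split=> //; exists (fset_set [set i | f i != 0]) => [i|].
  by rewrite in_fset_set // notin_setE /= => /negP; rewrite negbK => /eqP.
apply: fsbigTE => i.
by rewrite in_fset_set // notin_setE /= => /negP; rewrite negbK => /eqP.
Qed.

Lemma sum_supp (A B : {fset I}) (f : I -> V) :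
    (forall i, i \notin A -> f i = 0) -> (A `<=` B)%fset ->
  \sum_(i <- A) f i = \sum_(i <- B) f i.
Proof.
move=> fA0 /fsubsetP AB; rewrite -(fsbigTE _ _ fA0) (fsbigTE B) // => i iB.
by apply: fA0; apply: contra iB => /AB.
Qed.

Lemma decompositionB C x y f g : decomposition C x f -> decomposition C y g ->
  decomposition C (x - y) (fun i => f i - g i).
Proof.
move=> /decompositionP[fC [A fA0 ->]] /decompositionP[gC [B gB0 ->]].
apply/decompositionP; split=> [i|]; first by rewrite rpredB.
exists (A `|` B)%fset => [i|].
  by rewrite in_fsetU negb_or => /andP[/fA0-> /gB0->]; rewrite subr0.
by rewrite sumrB (sum_supp fA0 (fsubsetUl A B)) (sum_supp gB0 (fsubsetUr A B)).
Qed.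

Lemma decomposition0 C : decomposition C 0 (fun=> 0).
Proof.
apply/decompositionP; split=> [i|]; first exact: rpred0.
by exists fset0 => //; rewrite big_seq_fset0.
Qed.

Lemma subsum_zmod_closed C D : zmod_closed (subsum C D).
Proof.
split; first by apply/asboolP; exists (fun=> 0) => //; exact: decomposition0.
move=> x y /asboolP[f fx f0] /asboolP[g gy g0]; apply/asboolP.
exists (fun i => f i - g i); first exact: decompositionB.
by move=> i Di; rewrite f0 // g0 // subr0.
Qed.

HB.instance Definition _ C D :=
  GRing.isZmodClosed.Build V (subsum C D) (subsum_zmod_closed C D).

Lemma mem_subsum C D i x : x \in C i -> D i -> x \in subsum C D.
Proof.
move=> xC Di; apply/asboolP; exists (fun j => if j == i then x else 0).
  apply/decompositionP; split=> [j|].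
    by case: eqP => [->|_] //; exact: rpred0.
  exists [fset i]%fset => [j|]; first by rewrite inE => /negPf->.
  by rewrite big_seq_fset1 eqxx.
by move=> j Dj; case: eqP => // ji; rewrite ji in Dj.
Qed.

Lemma is_direct_sumP C : is_direct_sum C <->
  (forall x, exists f, decomposition C x f) /\
  (forall f, decomposition C 0 f -> forall i, f i = 0).
Proof.
split=> [dC|[exC unC] x].
  split=> [x|f f0 i]; first by have [f [fx _]] := dC x; exists f.
  have [g [_ gU]] := dC 0.
  by rewrite -(gU f f0) (gU _ (decomposition0 C)).
have [f fx] := exC x; exists f; split=> // g gx; apply: funext => i.
apply/eqP; rewrite -subr_eq0; apply/eqP.
apply: (unC (fun j => f j - g j)); rewrite -(subrr x).
exact: decompositionB.
Qed.

End DirectSum.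

Section Coarsening.
Variables (G H : choiceType) (psi : G -> H) (V : zmodType).

Definition coarsening (C : G -> zmodClosed V) : H -> zmodClosed V :=
  fun h => subsum C (psi @^-1` [set h]).

Lemma coarsening_direct_sum (C : G -> zmodClosed V) :
  is_direct_sum C -> is_direct_sum (coarsening C).
Proof.
move=> /is_direct_sumP[exC unC]; apply/is_direct_sumP; split.
  move=> x; have [f /decompositionP[fC [A fA0 ->]]] := exC x.
  exists (fun h => \sum_(g <- A | psi g == h) f g); apply/decompositionP.
  split=> [h|].
    by apply: rpred_sum => g /eqP gh; apply: mem_subsum (fC g) gh.
  exists [fset psi g | g in A]%fset => [h hA|].
    rewrite big_seq_cond big1 // => g /andP[gA /eqP gh].
    by case/negP: hA; rewrite -gh; apply: in_imfset.
  exact: (partition_big_imfset _ psi).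
move=> F /decompositionP[FC [B FB0 sF]].
have /choice[f fP] : forall h, exists f,
    decomposition C (F h) f /\ forall g, psi g <> h -> f g = 0.
  by move=> h; have /asboolP[f ? ?] := FC h; exists f.
have fD h : exists A : {fset G}, (forall g, g \notin A -> f h g = 0) /\
    F h = \sum_(g <- A) f h g.
  have [/decompositionP[_ [A ? ?]] _] := fP h.
  by exists A.
have [A AP] := choice fD.
have f0 : forall g, f (psi g) g = 0.
  pose S := (\bigcup_(h <- B) A h)%fset.
  have FS h : h \in B -> F h = \sum_(g <- S) f h g.
    move=> hB; rewrite (AP h).2; apply: sum_supp (AP h).1 _.
    by apply: bigfcup_sup.
  have fB h g : h \notin B -> f h g = 0.
    move=> /FB0 Fh0; apply: unC; rewrite -Fh0; exact: (fP h).1.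
  apply: (unC (fun g => f (psi g) g)); apply/decompositionP; split=> [g|].
    by have [[]] := fP (psi g).
  exists S => [g gS|].
    have [psiB|] := boolP (psi g \in B); last exact: fB.
    apply: (AP (psi g)).1; apply: contra gS => gA.
    by apply/bigfcupP; exists (psi g); rewrite ?psiB.
  rewrite [LHS]sF [LHS](eq_big_seq _ FS) exchange_big /=; apply: eq_bigr => g _.
  have [psiB|psiB] := boolP (psi g \in B).
    rewrite (big_fsetD1 (psi g)) //= big_seq big1 ?addr0 // => h.
    rewrite !inE => /andP[/eqP hg _]; apply: (fP h).2 => gh.
    exact: hg (esym gh).
  rewrite fB // big_seq big1 // => h hB; apply: (fP h).2 => gh.
  by rewrite gh hB in psiB.
move=> h; rewrite (AP h).2 big1 // => g _.
by have [<-|gh] := pselect (psi g = h); [exact: f0|exact: (fP h).2].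
Qed.

End Coarsening.

Record gradedRing (G : zmodType) := GradedRing {
  gring :> comPzRingType;
  gring_comp : G -> zmodClosed gring;
  gring_direct_sum : is_direct_sum gring_comp;
  gring_mul : forall (g h : G) (r s : gring),
    r \in gring_comp g -> s \in gring_comp h -> r * s \in gring_comp (g + h)
}.

Record gradedModule (G : zmodType) (R : gradedRing G) := GradedModule {
  gmod :> lmodType R;
  gmod_comp : G -> zmodClosed gmod;
  gmod_direct_sum : is_direct_sum gmod_comp;
  gmod_scale : forall (g h : G) (r : R) (x : gmod),
    r \in gring_comp R g -> x \in gmod_comp h -> r *: x \in gmod_comp (g + h)
}.

Section Category.
Variables (G : zmodType) (R : gradedRing G).

Record gradedHom (M N : gradedModule R) := GradedHom {
  ghom :> {linear M -> N};
  ghom_comp : forall (g : G) (x : M),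
    x \in gmod_comp M g -> ghom x \in gmod_comp N g
}.

(* Equality of morphisms is expressed by [=1] on underlying maps. *)
Definition monomorphism (M N : gradedModule R) (u : gradedHom M N) : Prop :=
  forall (L : gradedModule R) (a b : gradedHom L M),
    u \o a =1 u \o b -> a =1 b.

Definition injective_object (M : gradedModule R) : Prop :=
  forall (A B : gradedModule R) (i : gradedHom A B) (f : gradedHom A M),
    monomorphism i -> exists e : gradedHom B M, e \o i =1 f.

End Category.

Section CoarseningFunctor.
Variables (G H : zmodType) (psi : {additive G -> H}).

Lemma coarsening_act (U V W : zmodType) (op : U -> V -> W)
    (C : G -> zmodClosed U) (D : G -> zmodClosed V) (E : G -> zmodClosed W) :
    (forall y, {morph op^~ y : x z / x + z}) -> (forall y, op 0 y = 0) ->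
    (forall x, {morph op x : y z / y + z}) -> (forall x, op x 0 = 0) ->
    (forall g h x y, x \in C g -> y \in D h -> op x y \in E (g + h)) ->
  forall h k x y, x \in coarsening psi C h -> y \in coarsening psi D k ->
    op x y \in coarsening psi E (h + k).
Proof.
move=> opDl op0l opDr op0r opE h k x y.
move=> /asboolP[f /decompositionP[fC [A _ ->]] f0].
move=> /asboolP[f' /decompositionP[fD [B _ ->]] f'0].
rewrite (big_morph (op^~ _) (opDl _) (op0l _)); apply: rpred_sum => g _.
rewrite (big_morph (op _) (opDr _) (op0r _)); apply: rpred_sum => g' _.
have [gh|/f0->] := pselect (psi g = h); last by rewrite op0l rpred0.
have [gk|/f'0->] := pselect (psi g' = k); last by rewrite op0r rpred0.
apply: mem_subsum (opE _ _ _ _ (fC g) (fD g')) _.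
by rewrite /= raddfD gh gk.
Qed.

Lemma coarsen_ring_mul (R : gradedRing G) (h k : H) (r s : R) :
  r \in coarsening psi (gring_comp R) h ->
  s \in coarsening psi (gring_comp R) k ->
  r * s \in coarsening psi (gring_comp R) (h + k).
Proof.
apply: (coarsening_act (op := *%R)).
- by move=> y x z; rewrite mulrDl.
- exact: mul0r.
- by move=> x y z; rewrite mulrDr.
- exact: mulr0.
- exact: gring_mul.
Qed.

Definition coarsen_ring (R : gradedRing G) : gradedRing H :=
  GradedRing (coarsening_direct_sum psi (@gring_direct_sum G R))
             (@coarsen_ring_mul R).

Variable R : gradedRing G.

Lemma coarsen_module_scale (M : gradedModule R) (h k : H) (r : R) (x : M) :
  r \in coarsening psi (gring_comp R) h ->
  x \in coarsening psi (gmod_comp M) k ->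
  r *: x \in coarsening psi (gmod_comp M) (h + k).
Proof.
apply: (coarsening_act (op := *:%R)).
- by move=> y s t; rewrite scalerDl.
- exact: scale0r.
- by move=> s y z; rewrite scalerDr.
- exact: scaler0.
- exact: gmod_scale.
Qed.

Definition coarsen_module (M : gradedModule R) :
    gradedModule (coarsen_ring R) :=
  @GradedModule H (coarsen_ring R) (gmod M) (coarsening psi (gmod_comp M))
    (coarsening_direct_sum psi (@gmod_direct_sum G R M))
    (@coarsen_module_scale M).

Lemma coarsen_hom_comp (M N : gradedModule R) (u : gradedHom M N) (h : H)
    (x : M) :
  x \in coarsening psi (gmod_comp M) h ->
  u x \in coarsening psi (gmod_comp N) h.
Proof.
move=> /asboolP[f /decompositionP[fM [A _ ->]] f0].
rewrite raddf_sum; apply: rpred_sum => g _.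
have [gh|/f0->] := pselect (psi g = h); last by rewrite raddf0 rpred0.
exact: mem_subsum (ghom_comp u (fM g)) gh.
Qed.

Definition coarsen_hom (M N : gradedModule R) (u : gradedHom M N) :
    gradedHom (coarsen_module M) (coarsen_module N) :=
  @GradedHom H (coarsen_ring R) (coarsen_module M) (coarsen_module N)
    (ghom u) (@coarsen_hom_comp M N u).

End CoarseningFunctor.

(* Main.v *)
From HB Require Import structures.
Require Import Defs.
From mathcomp Require Import all_boot all_algebra finmap.
From mathcomp Require Import boolp classical_sets functions cardinality fsbigop.

Set Implicit Arguments.
Unset Strict Implicit.
Unset Printing Implicit Defensive.

Import GRing.Theory.

Local Open Scope classical_set_scope.
Local Open Scope ring_scope.

(* The refinement of an H-graded module N is the G-graded module with component
   N_(psi g) in degree g.  Refinement is exact, and when Ker psi is finite it is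
   left adjoint to coarsening (an element of degree h is sent to the finite sum
   of its copies in the degrees g with psi g = h), so coarsening preserves
   injectives.

   Conversely, let R be the Boolean ring of all functions nat -> bool, in
   degree 0.  It is self-injective, so its refinement M, which has component R
   in each degree of Ker psi, is injective.  The coarsening of M is the module
   of finitely supported functions Ker psi -> R; if Ker psi is infinite, this
   is not a direct summand of the module of all functions. *)

(** * Homogeneous components in a direct sum *)

Section Components.
Variables (I : choiceType) (V : zmodType) (C : I -> zmodClosed V).
Hypothesis dC : is_direct_sum C.

Definition component (i : I) (x : V) : V := sval (cid (dC x)) i.

Lemma component_decomposition x : decomposition C x (component^~ x).
Proof. exact: (svalP (cid (dC x))).1. Qed.

Lemma component_unique x f : decomposition C x f ->
  forall i, component i x = f i.
Proof. by move=> xf i; rewrite /component ((svalP (cid (dC x))).2 _ xf). Qed.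

Lemma component_mem i x : component i x \in C i.
Proof. by case: (component_decomposition x). Qed.

Lemma component_support x : exists2 A : {fset I},
  forall i, i \notin A -> component i x = 0 & x = \sum_(i <- A) component i x.
Proof. by have /decompositionP[] := component_decomposition x. Qed.

Fact component_zmod_morphism i : zmod_morphism (component i).
Proof.
move=> x y; rewrite (component_unique (decompositionB
  (component_decomposition x) (component_decomposition y))) //.
Qed.

HB.instance Definition _ i := GRing.isZmodMorphism.Build V V (component i)
  (component_zmod_morphism i).

Lemma component_homogeneous i x j : x \in C i ->
  component j x = if j == i then x else 0.
Proof.
move=> xi; apply: (@component_unique x (fun j => if j == i then x else 0)).
apply/decompositionP; split=> [k|].
  by case: eqP => [->|_] //; exact: rpred0.
exists [fset i]%fset => [k|]; first by rewrite inE => /negPf->.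
by rewrite big_seq_fset1 eqxx.
Qed.

Lemma component_id i x : x \in C i -> component i x = x.
Proof. by move=> /component_homogeneous->; rewrite eqxx. Qed.

Lemma component_inj x y : (forall i, component i x = component i y) -> x = y.
Proof.
move=> xy; apply/eqP; rewrite -subr_eq0; apply/eqP.
have [A _ ->] := component_support (x - y).
by rewrite big1 // => i _; rewrite raddfB /= xy subrr.
Qed.

Lemma homogeneous_ind (P : V -> Prop) :
  P 0 -> (forall x y, P x -> P y -> P (x + y)) ->
  (forall i x, x \in C i -> P x) -> forall x, P x.
Proof.
move=> P0 PD Phom x; have [A _ ->] := component_support x.
by elim/big_ind: _ => // i _; apply: Phom (component_mem i x).
Qed.

(** Universal property of the direct sum: additive maps [Phi i], one for each degree, glue to one
    additive map on [V]. The scalar multiplication of a refinement is built this way. *)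
Definition sum_components (W : zmodType) (Phi : I -> V -> W) (x : V) : W :=
  \sum_(i \in [set: I]) Phi i (component i x).

Section SumComponents.
Variables (W : zmodType) (Phi : I -> V -> W).
Hypothesis PhiB : forall i, zmod_morphism (Phi i).

Let Phi0 i : Phi i 0 = 0.
Proof. by have := PhiB i 0 0; rewrite !subrr. Qed.

Lemma sum_componentsB : zmod_morphism (sum_components Phi).
Proof.
move=> x y; have [A xA _] := component_support x.
have [B yB _] := component_support y.
rewrite /sum_components !(fsbigTE (A `|` B)%fset) -?sumrB.
- by apply: eq_bigr => i _; rewrite raddfB PhiB.
- by move=> i; rewrite in_fsetU negb_or => /andP[_ /yB->].
- by move=> i; rewrite in_fsetU negb_or => /andP[/xA-> _].
- by move=> i; rewrite in_fsetU negb_or raddfB /= =>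
    /andP[/xA-> /yB->]; rewrite subrr.
Qed.

Lemma sum_components_homogeneous i x : x \in C i ->
  sum_components Phi x = Phi i x.
Proof.
move=> xi; rewrite /sum_components (fsbigTE [fset i]%fset) => [|j].
  by rewrite big_seq_fset1 component_id.
by rewrite inE (component_homogeneous _ xi) => /negPf->.
Qed.

End SumComponents.

End Components.

Lemma coarseningP (G H : choiceType) (psi : G -> H) (V : zmodType)
    (C : G -> zmodClosed V) (dC : is_direct_sum C) (h : H) (x : V) :
  x \in coarsening psi C h <-> forall g, psi g <> h -> component dC g x = 0.
Proof.
split=> [/asboolP[f xf f0] g gh|x0].
  by rewrite (component_unique _ xf); exact: f0.
apply/asboolP; exists (component dC ^~ x) => //.
exact: component_decomposition.
Qed.

(** Reduces linearity to homogeneous scalars, the only ones for which the action on a refinement has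
    an explicit formula. *)
Lemma scalable_homogeneous (R : pzRingType) (I : choiceType)
    (C : I -> zmodClosed R) (dC : is_direct_sum C) (M N : lmodType R)
    (u : M -> N) :
  zmod_morphism u ->
  (forall i r x, r \in C i -> u (r *: x) = r *: u x) -> scalable u.
Proof.
move=> uB uZ r x; have u0 : u 0 = 0 by have := uB 0 0; rewrite !subrr.
have uD y z : u (y + z) = u y + u z.
  by apply/eqP; rewrite -subr_eq -uB addrK.
elim/(homogeneous_ind dC): r => [|r s rP sP|i r ri]; last exact: uZ _ _ _ ri.
  by rewrite !scale0r.
by rewrite !scalerDl uD rP sP.
Qed.

(** * Graded morphisms and monomorphisms *)

Section GradedModules.
Variables (G : zmodType) (R : gradedRing G).
Implicit Types (M N : gradedModule R).

Definition mcomp M : G -> M -> M := component (@gmod_direct_sum G R M).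
Definition rcomp : G -> R -> R := component (@gring_direct_sum G R).

HB.instance Definition _ M g := GRing.isZmodMorphism.Build M M (@mcomp M g)
  (component_zmod_morphism _ g).
HB.instance Definition _ g := GRing.isZmodMorphism.Build R R (rcomp g)
  (component_zmod_morphism _ g).

Lemma mcomp_scale M (k g : G) (r : R) (x : M) : r \in gring_comp R k ->
  mcomp (k + g) (r *: x) = r *: mcomp g x.
Proof.
move=> rk.
elim/(homogeneous_ind (@gmod_direct_sum G R M)): x => [|x y xP yP|h x xh].
- by rewrite scaler0 !raddf0.
- by rewrite scalerDr !raddfD /= xP yP.
- rewrite /mcomp (component_homogeneous _ _ xh).
  rewrite (component_homogeneous _ _ (gmod_scale rk xh)).
  by rewrite (inj_eq (addrI k)); case: eqP; rewrite ?scaler0.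
Qed.

Lemma ghomZ M N (u : gradedHom M N) (r : R) x : u (r *: x) = r *: u x.
Proof. exact: linearZ. Qed.

Lemma ghom_mcomp M N (u : gradedHom M N) g x : mcomp g (u x) = u (mcomp g x).
Proof.
elim/(homogeneous_ind (@gmod_direct_sum G R M)): x => [|x y xP yP|h x xh].
- by rewrite !raddf0.
- by rewrite !raddfD /= xP yP.
- rewrite /mcomp (component_homogeneous _ _ xh).
  rewrite (component_homogeneous _ _ (ghom_comp u xh)).
  by case: eqP; rewrite ?raddf0.
Qed.

(* The degree 0 component of 1 acts as a unit on homogeneous elements. *)
Lemma one_degree0 : 1 \in gring_comp R 0.
Proof.
have e0 r : r * rcomp 0 1 = r.
  elim/(homogeneous_ind (@gring_direct_sum G R)): r => [|r s rP sP|k r rk].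
  - by rewrite mul0r.
  - by rewrite mulrDl rP sP.
  (* Multiplying the decomposition of 1 by [r] of degree [k] decomposes [r * 1 = r]. By uniqueness
     its term in degree [k], which is [r * rcomp 0 1], equals [r]. *)
  have : decomposition (gring_comp R) r (fun g => r * rcomp (g - k) 1).
    have [A A0 s1] := component_support (@gring_direct_sum G R) 1.
    apply/decompositionP; split=> [g|].
      rewrite -[X in gring_comp R X](subrKC k).
      exact: gring_mul rk (component_mem _ _ _).
    exists [fset (g + k)%R | g in A]%fset => [g gA|].
      rewrite /rcomp A0 ?mulr0 //; apply: contra gA => gA.
      by apply/imfsetP; exists (g - k); rewrite //= subrK.
    rewrite big_imfset /= => [|g h _ _ /addIr //].
    rewrite -[LHS]mulr1 [in LHS]s1 mulr_sumr.
    by apply: eq_bigr => g _; rewrite addrK.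
  move=> /(component_unique (@gring_direct_sum G R))/(_ k).
  by rewrite subrr (component_id _ rk).
by rewrite -[1](e0 1) mul1r component_mem.
Qed.

Definition graded_hom M N (u : M -> N) (uB : zmod_morphism u)
    (uZ : scalable u)
    (uC : forall g x, x \in gmod_comp M g -> u x \in gmod_comp N g) :
    gradedHom M N :=
  @GradedHom G R M N (HB.pack u (GRing.isZmodMorphism.Build M N u uB)
    (GRing.isScalable.Build R M N *:%R u uZ)) uC.

Lemma injective_monomorphism M N (u : gradedHom M N) :
  injective u -> monomorphism u.
Proof. by move=> u_inj L a b ab x; apply: u_inj; exact: ab. Qed.

Lemma shift_direct_sum (g : G) :
  is_direct_sum (fun k => gring_comp R (k - g)).
Proof.
apply/is_direct_sumP; split=> [r|f].
  exists (fun k => rcomp (k - g) r); apply/decompositionP; split=> [k|].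
    exact: component_mem.
  have [A A0 sr] := component_support (@gring_direct_sum G R) r.
  exists [fset (k + g)%R | k in A]%fset => [k kA|].
    apply: A0; apply: contra kA => kA.
    by apply/imfsetP; exists (k - g); rewrite //= subrK.
  rewrite big_imfset /= => [|h k _ _ /addIr //].
  by rewrite [LHS]sr; apply: eq_bigr => k _; rewrite addrK.
move=> /decompositionP[fC [A fA0 s0]] k.
have : decomposition (gring_comp R) 0 (fun k => f (k + g)).
  apply/decompositionP; split=> [h|].
    by have := fC (h + g); rewrite addrK.
  exists [fset (k - g)%R | k in A]%fset => [h hA|].
    apply: fA0; apply: contra hA => hA.
    by apply/imfsetP; exists (h + g); rewrite //= addrK.
  rewrite big_imfset /= => [|h l _ _ /addIr //].
  by rewrite [LHS]s0; apply: eq_bigr => h _; rewrite subrK.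
move=> /(component_unique (@gring_direct_sum G R))/(_ (k - g)).
by rewrite raddf0 subrK.
Qed.

Lemma shift_scale (g h k : G) (r : R) (s : (R : pzRingType)^o) :
  r \in gring_comp R h -> s \in gring_comp R (k - g) ->
  r *: s \in gring_comp R (h + k - g).
Proof. by rewrite -addrA; exact: gring_mul. Qed.

(** The free graded module R(-g): its generator 1 sits in degree [g], so it represents the functor
    taking a graded module to its component of degree [g]. *)
Definition shift_ring (g : G) : gradedModule R :=
  @GradedModule G R (R : pzRingType)^o (fun k => gring_comp R (k - g))
    (shift_direct_sum g) (@shift_scale g).

Section Generator.
Variables (M : gradedModule R) (g : G) (x : M).
Hypothesis xg : x \in gmod_comp M g.

Let mulx (r : shift_ring g) : M := (r : R) *: x.

Fact mulx_zmod_morphism : zmod_morphism mulx.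
Proof. by move=> r s; rewrite /mulx scalerBl. Qed.

Fact mulx_scalable : scalable mulx.
Proof. by move=> r s; rewrite /mulx scalerA. Qed.

Fact mulx_comp k r :
  r \in gmod_comp (shift_ring g) k -> mulx r \in gmod_comp M k.
Proof. by move=> rk; rewrite -[k](subrK g); exact: gmod_scale rk xg. Qed.

Definition generator_hom : gradedHom (shift_ring g) M :=
  graded_hom mulx_zmod_morphism mulx_scalable mulx_comp.

End Generator.

(* A homogeneous x in the kernel would give two morphisms R(-g) -> M equalised
   by u, namely multiplication by x and by 0. *)
Lemma monomorphism_injective M N (u : gradedHom M N) :
  monomorphism u -> injective u.
Proof.
move=> mono_u.
have ker0 g x : x \in gmod_comp M g -> u x = 0 -> x = 0.
  move=> xg ux.
  have := mono_u _ (generator_hom xg) (generator_hom (rpred0 (gmod_comp M g))).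
  move=> /(_ _ 1); rewrite /= scale1r scaler0; apply=> r /=.
  by rewrite scaler0 ghomZ ux scaler0 raddf0.
apply: raddf_inj => x ux.
apply: (component_inj (dC := @gmod_direct_sum G R M)) => g.
rewrite raddf0; apply: ker0 (component_mem _ _ _) _.
by rewrite -ghom_mcomp ux raddf0.
Qed.

End GradedModules.

(** * Refinement *)

Section Refinement.
Variables (G H : zmodType) (psi : {additive G -> H}) (R : gradedRing G).
Variable N : gradedModule (coarsen_ring psi R).

(** The external direct sum of the groups N_(psi g), encoded by finitely supported functions with
    values in [N] itself, which avoids a dependent codomain. *)
Definition refined : {pred G -> N} := fun F =>
  `[< (forall g, F g \in gmod_comp N (psi g)) /\
      exists A : {fset G}, forall g, g \notin A -> F g = 0 >].

Fact refined_zmod_closed : zmod_closed refined.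
Proof.
split=> [|F F' /asboolP[FN [A FA0]] /asboolP[F'N [B F'B0]]]; apply/asboolP.
  by split=> [g|]; [exact: rpred0 | exists fset0].
split=> [g|]; first by rewrite rpredB // ?FN ?F'N.
exists (A `|` B)%fset => g; rewrite in_fsetU negb_or => /andP[gA gB].
by rewrite -[LHS]/(F g - F' g) FA0 // F'B0 // subrr.
Qed.

HB.instance Definition _ := GRing.isZmodClosed.Build (G -> N) refined
  refined_zmod_closed.

Record refinement := Refinement {
  refinement_fun :> G -> N;
  refinementP : refinement_fun \in refined
}.

HB.instance Definition _ := [isSub for refinement_fun].
HB.instance Definition _ := [Choice of refinement by <:].
HB.instance Definition _ := [SubChoice_isSubZmodule of refinement by <:].

Lemma refinement_degree (F : refinement) g : F g \in gmod_comp N (psi g).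
Proof. by have /asboolP[] := refinementP F. Qed.

Lemma refinement_support (F : refinement) :
  exists A : {fset G}, forall g, g \notin A -> F g = 0.
Proof. by have /asboolP[] := refinementP F. Qed.

Lemma refinement_eq (F F' : refinement) : (forall g, F g = F' g) -> F = F'.
Proof. by move=> FF'; apply/val_inj/funext. Qed.

Lemma refinementB (F F' : refinement) g : (F - F') g = F g - F' g.
Proof. by []. Qed.

Lemma refinement_sum (J : Type) (s : seq J) (F : J -> refinement) g :
  (\sum_(j <- s) F j) g = \sum_(j <- s) F j g.
Proof. by elim/big_rec2: _ => // j x y _ <-. Qed.

(** The action of a scalar of degree [k]; [refine_scale_fun] extends it additively over the
    components of an arbitrary scalar. Both act on all functions [G -> N], and stability of
    [refined] is a separate fact. *)
Definition translate (F : G -> N) (k : G) (r : R) : G -> N :=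
  fun g => (r : coarsen_ring psi R) *: F (g - k).

Definition refine_scale_fun (r : R) (F : G -> N) : G -> N :=
  sum_components (@gring_direct_sum G R) (translate F) r.

Fact translate_zmod_morphism F k : zmod_morphism (translate F k).
Proof. by move=> r s; apply: funext => g; rewrite /translate scalerBl. Qed.

Lemma refine_scale_funE k (r : R) F : r \in gring_comp R k ->
  refine_scale_fun r F = translate F k r.
Proof. exact: (sum_components_homogeneous _ (@translate_zmod_morphism F)). Qed.

Lemma refine_scale_funDl F : {morph refine_scale_fun^~ F : r s / r + s}.
Proof.
have B := sum_componentsB (@gring_direct_sum G R) (@translate_zmod_morphism F).
move=> r s; apply/eqP; rewrite -subr_eq; apply/eqP.
by rewrite -[LHS]B addrK.
Qed.

Lemma refine_scale_fun0 F : refine_scale_fun 0 F = 0.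
Proof.
by apply: (addrI (refine_scale_fun 0 F)); rewrite -refine_scale_funDl !addr0.
Qed.

Lemma refine_scale_funDr r : {morph refine_scale_fun r : F F' / F + F'}.
Proof.
move=> F F'; elim/(homogeneous_ind (@gring_direct_sum G R)): r.
- by rewrite !refine_scale_fun0 addr0.
- by move=> r s rP sP; rewrite !refine_scale_funDl rP sP addrACA.
- move=> k r rk; rewrite !(refine_scale_funE _ rk); apply: funext => g.
  exact: scalerDr.
Qed.

Lemma refine_scale_refined r F :
  F \in refined -> refine_scale_fun r F \in refined.
Proof.
move=> /asboolP[FN [A FA0]]; elim/(homogeneous_ind (@gring_direct_sum G R)): r.
- by rewrite refine_scale_fun0 rpred0.
- by move=> r s rP sP; rewrite refine_scale_funDl rpredD.
- move=> k r rk; rewrite (refine_scale_funE _ rk); apply/asboolP; split=> [g|].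
    rewrite /translate -[X in psi X](subrKC k) raddfD.
    by apply: gmod_scale (FN _); exact: mem_subsum rk _.
  exists [fset (g + k)%R | g in A]%fset => g gA.
  rewrite /translate FA0 ?scaler0 //.
  by apply: contra gA => gA; apply/imfsetP; exists (g - k); rewrite //= subrK.
Qed.

Definition refine_scale (r : R) (F : refinement) : refinement :=
  Refinement (refine_scale_refined r (refinementP F)).

Fact refine_scaleA r s F :
  refine_scale r (refine_scale s F) = refine_scale (r * s) F.
Proof.
apply: val_inj => /=; move: (F : G -> N) => {}F.
elim/(homogeneous_ind (@gring_direct_sum G R)): r => [|r r' rP r'P|k r rk].
- by rewrite mul0r !refine_scale_fun0.
- by rewrite mulrDl !refine_scale_funDl rP r'P.
elim/(homogeneous_ind (@gring_direct_sum G R)): s => [|s s' sP s'P|l s sl].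
- rewrite mulr0 !refine_scale_fun0 (refine_scale_funE _ rk); apply: funext => g.
  exact: scaler0.
- by rewrite mulrDr !refine_scale_funDl refine_scale_funDr sP s'P.
rewrite (refine_scale_funE _ rk) (refine_scale_funE _ sl).
rewrite (refine_scale_funE _ (gring_mul rk sl)); apply: funext => g.
by rewrite /translate scalerA opprD addrA.
Qed.

Fact refine_scale1 : left_id 1 refine_scale.
Proof.
move=> F; apply: refinement_eq => g /=.
by rewrite (refine_scale_funE _ (one_degree0 R)) /translate scale1r subr0.
Qed.

Fact refine_scaleDr : right_distributive refine_scale +%R.
Proof. by move=> r F F'; apply: val_inj; exact: refine_scale_funDr. Qed.

Fact refine_scaleDl F : {morph refine_scale^~ F : r s / r + s}.
Proof. by move=> r s; apply: val_inj; exact: refine_scale_funDl. Qed.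

HB.instance Definition _ := GRing.Zmodule_isLmodule.Build R refinement
  refine_scaleA refine_scale1 refine_scaleDr refine_scaleDl.

Lemma refinement_scaleE k (r : R) (F : refinement) g : r \in gring_comp R k ->
  (r *: F) g = (r : coarsen_ring psi R) *: F (g - k).
Proof.
by move=> rk; rewrite -[LHS]/(refine_scale_fun r F g) (refine_scale_funE _ rk).
Qed.

Definition refine_comp (g : G) : {pred refinement} := fun F =>
  `[< forall g', g' <> g -> F g' = 0 >].

Fact refine_comp_zmod_closed g : zmod_closed (refine_comp g).
Proof.
split=> [|F F' /asboolP F0 /asboolP F'0]; apply/asboolP => // g' gg'.
by rewrite refinementB F0 // F'0 // subrr.
Qed.

HB.instance Definition _ g :=
  GRing.isZmodClosed.Build refinement (refine_comp g) (refine_comp_zmod_closed g).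

(** Projecting [x] to degree [psi g] makes [single g] a total additive map on [N], without a
    homogeneity condition on [x]. *)
Fact single_refined (g : G) (x : N) :
  (fun g' => if g' == g then mcomp (psi g) x else 0) \in refined.
Proof.
apply/asboolP; split=> [g'|].
  by case: eqP => [->|_]; [exact: component_mem | exact: rpred0].
by exists [fset g]%fset => g'; rewrite inE => /negPf->.
Qed.

Definition single g x := Refinement (single_refined g x).

Lemma singleE g x g' : single g x g' = if g' == g then mcomp (psi g) x else 0.
Proof. by []. Qed.

Lemma single_mem g x : single g x \in refine_comp g.
Proof. by apply/asboolP => g'; rewrite singleE; case: eqP. Qed.

Lemma refine_direct_sum : is_direct_sum refine_comp.
Proof.
apply/is_direct_sumP; split=> [F|f].
  exists (fun g => single g (F g)); apply/decompositionP.
  split=> [g|]; first exact: single_mem.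
  have [A FA0] := refinement_support F; exists A => [g gA|].
    by apply: refinement_eq => g'; rewrite singleE FA0 // raddf0 if_same.
  apply: refinement_eq => g; rewrite refinement_sum.
  have FE : F g = single g (F g) g.
    by rewrite singleE eqxx /mcomp component_id // refinement_degree.
  have [gA|gA] := boolP (g \in A).
    rewrite (big_fsetD1 g) // -FE big_seq big1 => [|g'].
      by rewrite /= addr0.
    by rewrite !inE singleE eq_sym => /andP[/negPf->].
  rewrite FA0 // big_seq big1 // => g' g'A; rewrite singleE.
  by case: eqP => // gg'; rewrite gg' g'A in gA.
move=> /decompositionP[fC [A fA0 s0]] g; apply: refinement_eq => g'.
have [-> {g'}|/eqP gg'] := eqVneq g' g; last by have /asboolP-> := fC g.
have [gA|/fA0-> //] := boolP (g \in A).
have := congr1 (fun F : refinement => F g) s0; rewrite refinement_sum.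
rewrite (big_fsetD1 g) //= big_seq big1 ?addr0 // => h.
rewrite !inE => /andP[/eqP hg _]; have /asboolP -> // := fC h.
exact: nesym.
Qed.

Fact refine_gmod_scale (k h : G) (r : R) (F : refinement) :
  r \in gring_comp R k -> F \in refine_comp h -> r *: F \in refine_comp (k + h).
Proof.
move=> rk /asboolP F0; apply/asboolP => g gkh.
rewrite (refinement_scaleE _ _ rk) F0 ?scaler0 // => gh.
by apply: gkh; rewrite -gh subrKC.
Qed.

Definition refine : gradedModule R :=
  @GradedModule G R refinement refine_comp refine_direct_sum refine_gmod_scale.

End Refinement.

(** * Finite kernel *)

Section CoarseningInjective.
Variables (G H : zmodType) (psi : {additive G -> H}) (R : gradedRing G).

Lemma mcomp_fsum (M : gradedModule R) (f : G -> M) (A : {fset G}) :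
  (forall g, f g \in gmod_comp M g) -> (forall g, g \notin A -> f g = 0) ->
  forall g, mcomp g (\sum_(g \in [set: G]) f g) = f g.
Proof.
move=> fM fA0; apply: component_unique; apply/decompositionP; split=> //.
by exists A => //; exact: fsbigTE.
Qed.

Lemma mcomp_coarsen (M : gradedModule R) g (x : M) :
  mcomp g (mcomp (psi g) (x : coarsen_module psi M) : M) = mcomp g x.
Proof.
elim/(homogeneous_ind (@gmod_direct_sum G R M)): x => [|x y xP yP|k x xk].
- by rewrite [mcomp (psi g) _]raddf0.
- by rewrite [mcomp (psi g) _]raddfD /= [in LHS]raddfD /= xP yP raddfD.
have xk' : x \in coarsening psi (gmod_comp M) (psi k) by exact: mem_subsum xk _.
rewrite [mcomp (psi g) _](component_homogeneous _ _ xk').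
case: eqP => // gk; rewrite raddf0 /mcomp (component_homogeneous _ _ xk).
by case: eqP => // gk'; case: gk; rewrite gk'.
Qed.

Section RefineHom.
Variables (A B : gradedModule (coarsen_ring psi R)) (u : gradedHom A B).

Fact refine_hom_refined (F : refine A) :
  (fun g => u ((F : refinement A) g)) \in @refined _ _ _ _ B.
Proof.
apply/asboolP; split=> [g|]; first exact: ghom_comp (refinement_degree F g).
have [S FS0] := refinement_support F; exists S => g gS.
by rewrite FS0 ?raddf0.
Qed.

Let refine_hom_fun (F : refine A) : refine B :=
  Refinement (refine_hom_refined F).

Fact refine_hom_zmod_morphism : zmod_morphism refine_hom_fun.
Proof. by move=> F F'; apply: refinement_eq => g; exact: raddfB. Qed.

Fact refine_hom_scalable : scalable refine_hom_fun.
Proof.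
apply: (scalable_homogeneous (@gring_direct_sum G R)) => [|k r F rk].
  exact: refine_hom_zmod_morphism.
apply: refinement_eq => g; rewrite (refinement_scaleE _ _ rk).
rewrite -[LHS]/(u ((r *: (F : refinement A)) g)) (refinement_scaleE _ _ rk).
exact: ghomZ.
Qed.

Fact refine_hom_comp g F :
  F \in gmod_comp (refine A) g -> refine_hom_fun F \in gmod_comp (refine B) g.
Proof.
by move=> /asboolP F0; apply/asboolP => g' gg'; rewrite /= F0 ?raddf0.
Qed.

Definition refine_hom : gradedHom (refine A) (refine B) :=
  graded_hom refine_hom_zmod_morphism refine_hom_scalable refine_hom_comp.

End RefineHom.

Lemma refine_hom_injective (A B : gradedModule (coarsen_ring psi R))
    (u : gradedHom A B) : injective u -> injective (refine_hom u).
Proof.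
move=> u_inj F F' FF'; apply: refinement_eq => g; apply: u_inj.
exact: (congr1 (fun K : refine B => (K : refinement B) g) FF').
Qed.

Variable M : gradedModule R.

(** * The adjunction between refinement and coarsening *)

Section ToRefined.
Variables (A : gradedModule (coarsen_ring psi R)).
Variable f : gradedHom A (coarsen_module psi M).

(** The copy in degree [g] of an element of A_(psi g) is sent by [f] into degree [psi g] of the
    coarsening, hence into a sum of several components of [M]; only the one of degree [g] is
    kept. *)
Let untranspose (F : refine A) : M :=
  \sum_(g \in [set: G]) mcomp g (f ((F : refinement A) g) : M).

Fact mcomp_untranspose F g :
  mcomp g (untranspose F) = mcomp g (f ((F : refinement A) g) : M).
Proof.
have [S FS0] := refinement_support F.
apply: (@mcomp_fsum M _ S) g => g; first exact: component_mem.
by move=> gS; rewrite FS0 ?raddf0 // [f 0]raddf0 raddf0.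
Qed.

Fact untranspose_zmod_morphism : zmod_morphism untranspose.
Proof.
move=> F F'; apply: (component_inj (dC := @gmod_direct_sum G R M)) => g.
by rewrite raddfB /= -!/(mcomp g _) !mcomp_untranspose [f _]raddfB raddfB.
Qed.

Fact untranspose_scalable : scalable untranspose.
Proof.
apply: (scalable_homogeneous (@gring_direct_sum G R)) => [|k r F rk].
  exact: untranspose_zmod_morphism.
apply: (component_inj (dC := @gmod_direct_sum G R M)) => g.
rewrite -!/(mcomp g _) mcomp_untranspose (refinement_scaleE _ _ rk) [f _]ghomZ.
rewrite -[X in mcomp X _ = _](subrKC k) -[X in _ = mcomp X _](subrKC k).
by rewrite !(mcomp_scale _ _ rk) mcomp_untranspose.
Qed.

Fact untranspose_comp g F :
  F \in gmod_comp (refine A) g -> untranspose F \in gmod_comp M g.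
Proof.
move=> /asboolP F0; rewrite /untranspose (fsbigTE [fset g]%fset) => [|g'].
  by rewrite big_seq_fset1 component_mem.
by rewrite inE => /eqP/F0->; rewrite [f 0]raddf0 raddf0.
Qed.

Definition untranspose_hom : gradedHom (refine A) M :=
  graded_hom untranspose_zmod_morphism untranspose_scalable untranspose_comp.

Lemma untranspose_single g x :
  untranspose_hom (single g (x : A)) = mcomp g (f x : M).
Proof.
have := untranspose_comp (single_mem g x).
move=> /(component_id (@gmod_direct_sum G R M)) e_g.
rewrite -[LHS]/(untranspose (single g x)) -e_g.
rewrite -/(mcomp g _) mcomp_untranspose singleE eqxx.
by rewrite -ghom_mcomp mcomp_coarsen.
Qed.

End ToRefined.

Section FromRefined.
Hypothesis psi_surj : forall h : H, exists g : G, psi g = h.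
Hypothesis psi_fin : finite_set [set g : G | psi g = 0].
Variables (B : gradedModule (coarsen_ring psi R)) (e : gradedHom (refine B) M).

(** This is where the finiteness of Ker psi enters: the fibre over [h] is the translate of the
    kernel by a chosen preimage [s h]. *)
Fact preimage_fset (S : {fset H}) : exists T : {fset G},
  forall g, psi g \in S -> g \in T.
Proof.
have [s sK] := choice psi_surj; have [K KE] := finite_fsetP.1 psi_fin.
exists [fset (s h + c)%R | h in S, c in K]%fset => g gS.
apply/imfset2P; exists (psi g) => //.
exists (g - s (psi g)); last by rewrite subrKC.
by have : [set` K] (g - s (psi g)) by rewrite -KE /= raddfB /= sK subrr.
Qed.

Lemma singleB g : zmod_morphism (@single _ _ _ _ B g).
Proof.
move=> x y; apply: refinement_eq => g'; rewrite refinementB !singleE raddfB.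
by case: ifP; rewrite ?subr0.
Qed.

Lemma single_scale g k r (x : B) : r \in gring_comp R k ->
  single (k + g) ((r : coarsen_ring psi R) *: x) =
  (r *: (single g x : refine B)).
Proof.
move=> rk; apply: refinement_eq => g'.
rewrite (refinement_scaleE _ _ rk) !singleE raddfD.
rewrite (@mcomp_scale _ _ _ (psi k)); last exact: mem_subsum rk _.
by rewrite subr_eq addrC; case: ifP; rewrite ?scaler0.
Qed.

(** The opposite direction of the adjunction. A term is nonzero only if [x] has a nonzero component
    in degree [psi g], so [preimage_fset] makes the sum finite. *)
Let transpose (x : B) : coarsen_module psi M :=
  \sum_(g \in [set: G]) e (single g x) : M.

Fact mcomp_transpose x g : mcomp g (transpose x : M) = e (single g x).
Proof.
have [S xS0 _] := component_support (@gmod_direct_sum _ _ B) x.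
have [T ST] := preimage_fset S.
apply: (@mcomp_fsum M _ T) g => g.
  by apply: (ghom_comp e); exact: single_mem.
move=> gT; suff -> : single g (x : B) = 0 by rewrite [e _]raddf0.
apply: refinement_eq => g'; rewrite singleE /mcomp xS0 ?if_same //.
by apply: contra gT; exact: ST.
Qed.

Fact transpose_zmod_morphism : zmod_morphism transpose.
Proof.
move=> x y; apply: (component_inj (dC := @gmod_direct_sum G R M)) => g.
by rewrite [RHS]raddfB /= -!/(mcomp g _) !mcomp_transpose singleB [e _]raddfB.
Qed.

Fact transpose_scalable : scalable transpose.
Proof.
apply: (scalable_homogeneous (@gring_direct_sum G R)) => [|k r x rk].
  exact: transpose_zmod_morphism.
apply: (component_inj (dC := @gmod_direct_sum G R M)) => g.
rewrite -!/(mcomp g _) mcomp_transpose -[g](subrKC k).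
rewrite (mcomp_scale _ _ rk) mcomp_transpose (single_scale _ _ rk).
exact: ghomZ.
Qed.

Fact transpose_comp h x :
  x \in gmod_comp B h -> transpose x \in gmod_comp (coarsen_module psi M) h.
Proof.
move=> xh; apply/(coarseningP psi (@gmod_direct_sum G R M)) => g gh.
rewrite -/(mcomp g _) mcomp_transpose.
suff -> : single g (x : B) = 0 by exact: raddf0.
apply: refinement_eq => g'.
rewrite singleE /mcomp (component_homogeneous _ _ xh).
by case: eqP => //; case: eqP.
Qed.

Definition transpose_hom : gradedHom B (coarsen_module psi M) :=
  graded_hom transpose_zmod_morphism transpose_scalable transpose_comp.

End FromRefined.

Lemma coarsen_injective :
  (forall h : H, exists g : G, psi g = h) ->
  finite_set [set g : G | psi g = 0] ->
  injective_object M -> injective_object (coarsen_module psi M).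
Proof.
move=> psi_surj psi_fin injM A B i f /monomorphism_injective i_inj.
(* Extend the transposed [f] along the refinement of [i], using that [M] is injective, and transpose
   the extension back. *)
have /injective_monomorphism/injM := refine_hom_injective i_inj.
move=> /(_ (untranspose_hom f))[e ei].
exists (transpose_hom psi_surj psi_fin e) => x.
(* In degree [g] the claim is that [e (single g (i x))] is the component of [f x]. As
   [single g (i x)] is the image of [single g x] under [refine_hom i], this is
   [untranspose_single]. *)
apply: (component_inj (dC := @gmod_direct_sum G R M)) => g.
rewrite -!/(mcomp g _) mcomp_transpose // -(untranspose_single f) -ei /=.
congr (e _); apply: refinement_eq => g'.
rewrite singleE /= ghom_mcomp; case: ifP => // _.
by rewrite [RHS]raddf0.
Qed.

End CoarseningInjective.

(** * Infinite kernel *)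

Section Concentrated.
Variables (H : zmodType) (V : zmodType).

Definition concentrated (h : H) : {pred V} := fun x => (h == 0) || (x == 0).

Lemma concentratedP h x : reflect (h <> 0 -> x = 0) (x \in concentrated h).
Proof.
rewrite /in_mem /= /concentrated; apply: (iffP idP) => [|x0].
  by case/orP => /eqP.
by case: eqP => //= /x0->; rewrite eqxx.
Qed.

Fact concentrated_zmod_closed h : zmod_closed (concentrated h).
Proof.
split=> [|x y /concentratedP x0 /concentratedP y0];
  apply/concentratedP => // h0.
by rewrite x0 // y0 // subrr.
Qed.

HB.instance Definition _ h := GRing.isZmodClosed.Build V (concentrated h)
  (concentrated_zmod_closed h).

Lemma concentrated_direct_sum : is_direct_sum concentrated.
Proof.
apply/is_direct_sumP; split=> [x|f].
  exists (fun h => if h == 0 then x else 0); apply/decompositionP.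
  split=> [h|]; first by apply/concentratedP; case: eqP.
  exists [fset 0]%fset => [h|]; first by rewrite inE => /negPf->.
  by rewrite big_seq_fset1 eqxx.
move=> /decompositionP[fC [A fA0 s0]].
have f0 h : h <> 0 -> f h = 0 by move=> h0; have /concentratedP-> := fC h.
move=> h; have [-> {h}|/eqP/f0 //] := eqVneq h 0; rewrite [RHS]s0.
have [A0|/fA0->//] := boolP (0 \in A).
rewrite (big_fsetD1 0) //= big_seq big1 ?addr0 // => h.
by rewrite !inE => /andP[/eqP/f0].
Qed.

End Concentrated.

Fact concentrated_mul (G : zmodType) (K : comPzRingType) (g h : G) (r s : K) :
  r \in concentrated g -> s \in concentrated h ->
  r * s \in concentrated (g + h).
Proof.
move=> /concentratedP r0 /concentratedP s0; apply/concentratedP => gh.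
have [g0|/eqP/r0->] := eqVneq g 0; last by rewrite mul0r.
have [h0|/eqP/s0->] := eqVneq h 0; last by rewrite mulr0.
by case: gh; rewrite g0 h0 addr0.
Qed.

Definition trivial_ring (G : zmodType) (K : comPzRingType) : gradedRing G :=
  @GradedRing G K (@concentrated G K) (@concentrated_direct_sum G K)
    (@concentrated_mul G K).

Lemma trivial_ring_degree0 (G : zmodType) (K : comPzRingType) (r : K) :
  r \in gring_comp (trivial_ring G K) 0.
Proof. by apply/concentratedP. Qed.

Lemma coarsen_trivial_ring_degree0 (G H : zmodType) (psi : {additive G -> H})
    (K : comPzRingType) (r : K) :
  r \in gring_comp (coarsen_ring psi (trivial_ring G K)) 0.
Proof. by apply: mem_subsum (trivial_ring_degree0 G r) _; exact: raddf0. Qed.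

Section ConcentratedModule.
Variables (H : zmodType) (S : gradedRing H).
Hypothesis S0 : forall r : S, r \in gring_comp S 0.
Variable V : lmodType S.

(** Hypothesis [S0] covers the coarsening of [trivial_ring], whose components are given by [subsum]
    and not by [concentrated]. Under it an [r] of degree [h <> 0] also has degree 0, hence
    vanishes. *)
Fact concentrated_scale (h k : H) (r : S) (x : V) : r \in gring_comp S h ->
  x \in concentrated k -> r *: x \in concentrated (h + k).
Proof.
move=> rh /concentratedP x0; apply/concentratedP => hk.
have [k0|/eqP/x0->] := eqVneq k 0; last by rewrite scaler0.
have h0 : h == 0 = false by apply/eqP => h0; case: hk; rewrite h0 k0 addr0.
rewrite -(component_id (@gring_direct_sum H S) rh).
by rewrite (component_homogeneous _ _ (S0 r)) h0 scale0r.
Qed.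

Definition concentrated_module : gradedModule S :=
  @GradedModule H S V (@concentrated H V) (@concentrated_direct_sum H V)
    concentrated_scale.

End ConcentratedModule.

(* A subgroup of B maximal among those containing i (ker f) but not a given
   i a with f a = true has index 2, and e is the corresponding character. *)
Lemma extend_bool_morphism (A B : zmodType) (i : A -> B) (f : A -> bool) :
  (forall x : B, x + x = 0) -> zmod_morphism i -> injective i ->
  zmod_morphism f ->
  exists e : B -> bool, zmod_morphism e /\ forall a, e (i a) = f a.
Proof.
move=> B2 iB i_inj fB.
have [[a0 fa0]|f0] := pselect (exists a, f a); last first.
  exists (fun=> false); split=> [x y|a]; first by rewrite subrr.
  by apply/esym/negP => fa; apply: f0; exists a.
pose good (X : set B) := [/\ forall x y, X x -> X y -> X (x - y),
  forall a, ~~ f a -> X (i a) & ~ X (i a0)].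
have f0 : f 0 = false by have := fB 0 0; rewrite !subrr.
have good0 X : good X -> X 0.
  case=> XB Xf _; have Xi0 : X (i 0) by apply: Xf; rewrite f0.
  by have := XB _ _ Xi0 Xi0; rewrite subrr.
have good_ker : good [set i a | a in [set a | ~~ f a]].
  split=> [_ _ [a /negPf fa <-] [b /negPf fb <-]|a fa|[a fa /i_inj aa0]].
  - by exists (a - b); rewrite ?iB //= fB fa fb.
  - by exists a.
  - by rewrite /= aa0 fa0 in fa.
have [F FP totF|X [+ Xmax]] := @Zorn_bigcup B [set X | X = set0 \/ good X].
  have [[X0 [FX0 gX0]]|noX] := pselect (exists X, F X /\ good X); last first.
    left; apply/seteqP; split=> // x [X FX Xx].
    by have [X0|gX] := FP _ FX; [rewrite X0 in Xx | case: noX; exists X].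
  have Fgood X x : F X -> X x -> good X.
    by move=> FX Xx; have [X0'|//] := FP _ FX; rewrite X0' in Xx.
  right; split=> [x y [X FX Xx] [Y FY Yy]|a fa|[X FX Xa0]].
  - have [XY|YX] := totF _ _ FX FY; [exists Y|exists X] => //.
      by have [YB _ _] := Fgood _ _ FY Yy; apply: YB; first exact: XY.
    by have [XB _ _] := Fgood _ _ FX Xx; apply: XB; last exact: YX.
  - by exists X0 => //; case: gX0 => _ + _; exact.
  - by have [_ _] := Fgood _ _ FX Xa0; exact.
case=> [X0|gX].
  case: (Xmax [set i a | a in [set a | ~~ f a]]); last by right.
  by rewrite X0; split=> [x //|/(_ 0)]; apply; exact: good0.
have [XB Xf Xa0] := gX.
have XX0 := good0 _ gX.
have opp (x : B) : - x = x by apply/eqP; rewrite eq_sym -addr_eq0 B2.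
(* X has just two cosets: if [x] is outside, the subgroup [X] together with [X + x] is strictly
   larger, so by maximality it contains [i a0]. *)
have Xv x : ~ X x -> X (i a0 - x).
  move=> Xx; apply: contrapT => Xa0x.
  apply: (Xmax [set y | X y \/ X (y - x)]).
    split=> [y Xy|]; first by left.
    by move=> /(_ x) Xx'; apply/Xx/Xx'; right; rewrite subrr.
  right; split=> [y z|a /Xf ?|[]//]; last by left.
  move=> [Xy|Xy] [Xz|Xz].
  - by left; exact: XB.
  - right=> /=; suff -> : y - z - x = y - (z - x) by exact: XB.
    by rewrite opprB (opp x) addrA addrAC.
  - by right; rewrite addrAC; exact: XB.
  - by left; have := XB _ _ Xy Xz; rewrite opprB addrA subrK.
exists (fun x => ~~ `[< X x >]); split=> [x y|a].
  have [Xx|Xx] := asboolP (X x); have [Xy|Xy] := asboolP (X y).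
  - by rewrite asboolT //; exact: XB.
  - by rewrite asboolF // => /(XB _ _ Xx); rewrite subKr.
  - rewrite asboolF // => Xxy; apply: Xx; have := XB _ _ Xxy Xy.
    by rewrite -addrA -opprD B2 subr0.
  - rewrite asboolT //; have := XB _ _ (Xv _ Xy) (Xv _ Xx).
    by rewrite opprB addrC addrA subrK.
have [fa|/Xf Xa] := boolP (f a); last by rewrite asboolT.
(* Here [f (a0 - a)] is false, so [i a0 - i a] lies in [X]; if [i a] did too, so would [i a0]. *)
rewrite asboolF // => Xa; apply: Xa0.
have Xaa : X (i (a0 - a)) by apply: Xf; rewrite fB fa fa0.
have := XB _ _ Xaa Xa.
by rewrite iB -addrA -opprD B2 subr0.
Qed.
Lemma infinite_set_sequence (T : choiceType) (X : set T) : ~ finite_set X ->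
  exists2 s : nat -> T, injective s & forall n, X (s n).
Proof.
move=> Xinf; have [x _] := infinite_setN0 Xinf.
(* [pcard_leP] needs a pointed codomain; a member of [X] serves as the point. *)
pose U : pointedType := HB.pack (T : Type) T (isPointed.Build T x).
have /(@pcard_leP _ U)[s] := (infiniteP X).1 Xinf; exists s => [m n|n].
  by apply: inj; rewrite inE.
exact: funS.
Qed.

(** * The counterexample over the Boolean ring of functions [nat -> bool] *)

Section BooleanCounterexample.
Variables (G H : zmodType) (psi : {additive G -> H}).

Let K : comPzRingType := (nat -> bool).
Let R := trivial_ring G K.
Let S := coarsen_ring psi R.

Let S0 (r : S) : r \in gring_comp S 0.
Proof. exact: coarsen_trivial_ring_degree0. Qed.

Definition boolean_module : gradedModule S :=
  concentrated_module S0 (S : pzRingType)^o.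

Let M := refine boolean_module.

(** The bits of [F], indexed by [G * nat]: they determine [F], and each is an additive map to
    [bool], where addition is exclusive or. *)
Let ev (F : M) (g : G) (n : nat) : bool :=
  ((F : refinement boolean_module) g : K) n.

(** The idempotent of [K] that cuts out its [n]-th factor [bool]. *)
Let delta (n : nat) : K := fun m => m == n.

Let evZ (r : K) (F : M) g n : ev ((r : R) *: F) g n = r n && ev F g n.
Proof.
by rewrite /ev (refinement_scaleE _ _ (trivial_ring_degree0 G r)) subr0.
Qed.

Let ev_mcomp (F : M) g n : ev (mcomp g F) g n = ev F g n.
Proof.
elim/(homogeneous_ind (@gmod_direct_sum G R M)): F => [|F F' FP F'P|h F Fh].
- by rewrite raddf0.
- rewrite raddfD.
  by rewrite -[LHS]/(ev (mcomp g F) g n + ev (mcomp g F') g n) FP F'P.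
- rewrite /mcomp (component_homogeneous _ _ Fh); case: eqP => // gh.
  by move: Fh => /asboolP Fh; rewrite /ev Fh.
Qed.

Let ev_kernel (F : M) g n : psi g <> 0 -> ev F g n = false.
Proof.
by move=> g0; have /concentratedP := refinement_degree F g; rewrite /ev => ->.
Qed.

Let boolean2 (A : gradedModule R) (x : A) : x + x = 0.
Proof.
by rewrite -[x]scale1r -scalerDl (_ : 1 + 1 = 0 :> R) ?scale0r.
Qed.

(** Each bit of [f] is a group morphism to [bool], so it extends along [i] by
    [extend_bool_morphism]. The extensions are merely additive; linearity and compatibility with the
    degrees are restored afterwards. *)
Lemma boolean_module_refine_injective : injective_object M.
Proof.
move=> A B i f /monomorphism_injective i_inj.
have /choice[e eP] : forall gn : G * nat, exists e : B -> bool,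
    zmod_morphism e /\ forall a, e (i a) = ev (f a) gn.1 gn.2.
  move=> [g n]; apply: extend_bool_morphism => //=; first exact: boolean2.
  - exact: raddfB.
  - by move=> a b; rewrite raddfB.
(* Taking the component of degree [g] makes the extension graded and finitely supported, and
   multiplying by [delta n] makes it linear, because [delta n * r] is [delta n] or 0 according to
   [r n]. Bits with [psi g <> 0] must vanish in [M]. *)
pose E (b : B) (g : G) : K := fun n =>
  if psi g == 0 then e (g, n) ((delta n : R) *: mcomp g b) else false.
have e0 gn : e gn 0 = 0 by have := (eP gn).1 0 0; rewrite !subrr.
have E_refined b :
    (E b : G -> boolean_module) \in @refined _ _ _ _ boolean_module.
  apply/asboolP; split=> [g|].
    by apply/concentratedP => g0; apply: funext => n; rewrite /E; case: eqP.
  have [A0 bA0 _] := component_support (@gmod_direct_sum G R B) b.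
  exists A0 => g gA; apply: funext => n.
  by rewrite /E /mcomp bA0 // scaler0 e0 if_same.
pose E' (b : B) : M := Refinement (E_refined b).
have E'E b g n : ev (E' b) g n = E b g n by [].
have evP (F F' : M) : (forall g n, ev F g n = ev F' g n) -> F = F'.
  by move=> FF'; apply: refinement_eq => g; apply: funext => n; exact: FF'.
have E'B : zmod_morphism E'.
  move=> b b'; apply: evP => g n.
  rewrite -[RHS]/(ev (E' b) g n - ev (E' b') g n) !E'E /E.
  by case: eqP => // _; rewrite raddfB scalerBr (eP (g, n)).1.
have E'Z : scalable E'.
  move=> r b; apply: evP => g n; rewrite evZ !E'E /E.
  case: eqP => [_|]; last by rewrite andbF.
  rewrite -[g in mcomp g (r *: b)]add0r.
  rewrite (mcomp_scale _ _ (trivial_ring_degree0 G r)).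
  rewrite scalerA (_ : (delta n : R) * r = if (r : K) n then delta n else 0).
    by case: ifP => _ //; rewrite scale0r e0.
  apply: funext => m; rewrite -[LHS]/((m == n) && (r : K) m).
  by case: eqP => [->|mn]; case: ifP => // _; rewrite /delta; case: eqP.
have E'C g b : b \in gmod_comp B g -> E' b \in gmod_comp M g.
  move=> bg; apply/asboolP => g' gg'; apply: funext => n.
  rewrite -[LHS]/(E b g' n) /E /mcomp (component_homogeneous _ _ bg).
  by case: (g' =P g) => // _; rewrite scaler0 e0 if_same.
exists (graded_hom E'B E'Z E'C) => a; apply: evP => g n.
rewrite -[LHS]/(E (i a) g n) /E; case: eqP => [g0|/ev_kernel->//].
rewrite ghom_mcomp -ghomZ (eP (g, n)).2 /= ghomZ evZ -ghom_mcomp ev_mcomp.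
by rewrite /delta eqxx.
Qed.

(** Functions on all of [G] stand in for functions on Ker psi; by [ev_kernel] the elements of [M]
    vanish off the kernel. *)
Let P : gradedModule S := concentrated_module S0 (G -> (S : pzRingType)^o).

Let iota (F : coarsen_module psi M) : P :=
  fun g => (F : refinement boolean_module) g.

Fact iota_zmod_morphism : zmod_morphism iota.
Proof. by []. Qed.

Fact iota_scalable : scalable iota.
Proof.
move=> r F; apply: funext => g; apply: funext => n.
by rewrite -[LHS]/(ev ((r : R) *: (F : M)) g n) evZ.
Qed.

Fact iota_comp h F :
  F \in gmod_comp (coarsen_module psi M) h -> iota F \in gmod_comp P h.
Proof.
move=> /(coarseningP psi (@gmod_direct_sum G R M)) F0.
apply/concentratedP => h0.
apply: funext => g; apply: funext => n; rewrite -[LHS]/(ev F g n).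
(* For [h <> 0], the values at [g] over [h] vanish since [g] is outside the kernel, and the others
   since [F] has degree [h]. *)
have [gh|/F0 Fg] := pselect (psi g = h); first by rewrite ev_kernel ?gh.
by rewrite -ev_mcomp /mcomp Fg.
Qed.

Definition iota_hom : gradedHom (coarsen_module psi M) P :=
  graded_hom iota_zmod_morphism iota_scalable iota_comp.

(* A retraction of the embedding of finitely supported functions into all
   functions would send p, given by p (g_n) = delta_n, to a function that does
   not vanish at any g_n: delta_n p is the image of a finitely supported one. *)
Lemma boolean_module_coarsen_refine_not_injective :
  ~ finite_set [set g : G | psi g = 0] ->
  ~ injective_object (coarsen_module psi M).
Proof.
move=> /infinite_set_sequence[s s_inj s0] injM.
have iota_inj : injective iota_hom by move=> F F' /= FF'; exact: val_inj.
have idC h (F : coarsen_module psi M) :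
    F \in gmod_comp (coarsen_module psi M) h ->
  idfun F \in gmod_comp (coarsen_module psi M) h by [].
have [e eK] :=
  injM _ _ iota_hom (GradedHom idC) (injective_monomorphism iota_inj).
pose p : P := fun g => (fun n => g == s n) : K.
have [A eA0] := refinement_support (e p : refinement boolean_module).
have sA n : s n \in A.
  apply: contrapT => /negP/eA0 epn.
  (* This is [delta n] times [p]: the bit of [p] at [(g, m)] is set exactly when [g = s m], and
     [delta n] keeps only [m = n]. *)
  pose d : M := single (s n) (delta n : boolean_module).
  have d_p : iota d = (delta n : S) *: p.
    apply: funext => g; apply: funext => m.
    rewrite -[RHS]/((m == n) && (g == s m)).
    rewrite -[LHS]/((single (s n) (delta n : boolean_module) g : K) m) singleE.
    rewrite s0 /mcomp component_id; last by apply/concentratedP.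
    have [->|gn] := eqVneq g (s n).
      by rewrite (inj_eq s_inj) [n == m]eq_sym andbb.
    by case: eqP => //= ->; rewrite (negPf gn).
  (* The retraction fixes [d], so linearity gives [d = delta n *: e p]. The bit at [(s n, n)] is
     true on the left and, by [epn], false on the right. *)
  have : ev d (s n) n = ev ((delta n : R) *: (e p : M)) (s n) n.
    congr (ev _ (s n) n); rewrite -[LHS]/(idfun (d : coarsen_module psi M)).
    by rewrite -eK /= d_p ghomZ.
  rewrite evZ {2}/ev epn andbF /ev singleE eqxx s0 /mcomp component_id.
    by rewrite /delta eqxx.
  by apply/concentratedP.
apply: infinite_nat; rewrite -(preimage_range s).
apply: finite_preimage => [m n _ _ /s_inj //|].
by apply: sub_finite_set (finite_fset A) => _ [n _ <-]; exact: sA.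
Qed.

End BooleanCounterexample.

Theorem mainTheorem1 (G H : zmodType) (psi : {additive G -> H})
    (psi_surj : forall h : H, exists g : G, psi g = h) :
  finite_set [set g : G | psi g = 0] <->
  (forall (R : gradedRing G) (M : gradedModule R),
     injective_object M -> injective_object (coarsen_module psi M)).
Proof.
split=> [psi_fin R M|preserves]; first exact: coarsen_injective.
apply: contrapT => psi_inf.
apply: (boolean_module_coarsen_refine_not_injective psi_inf).
exact/preserves/boolean_module_refine_injective.
Qed.
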